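(* Any permutation $\sigma$ of a finite set $S \subset \mathbb{N}$ can be uniquely decomposed into a tuple $(\pi^1, \dotsc, \pi^k)$ of inextendible atomic permutations $\pi^i$ of non-empty subsets $T_i \subseteq S$ such that $\pi^i_{|T_i|} = \pi^{i+1}_1$ for all $i < k$ (i.e. the last letter of $\pi^i$ equals the first letter of $\pi^{i+1}$) and $\bigcup_i T_i = S$. The $\pi^i$ are called the atoms of $\sigma$.
   Context: A permutation of a finite set $S \subset \mathbb{N}$ with $n$ elements is a linear ordering of its elements, written as a word $\sigma = \sigma_1 \sigma_2 \cdots \sigma_n$ in which each element of $S$ appears exactly once. A permutation of a non-empty finite set $T \subset \mathbb{N}$ is called atomic if its word either begins with the smallest and ends with the largest element of $T$ (rising atomic), or begins with the largest and ends with the smallest element of $T$ (falling atomic). In particular every permutation of a set with one or two elements is atomic. A permutation $\sigma$ of $S$ contains an atomic permutation $\pi$ of $T \subseteq S$ if $\pi$ is a subword of $\sigma$, where subword means a block of consecutive letters. An atomic permutation $\pi$ of $T$ contained in $\sigma$ is inextendible (in $\sigma$) if $\sigma$ contains no other atomic permutation $\pi'$ of a set $T' \subseteq S$ with $T \subsetneq T'$.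
   Formalization: When S = {a}, the tuples (a), (a,a), (a,a,a), … all meet the stated conditions, so uniqueness fails; the formal statement additionally requires, only when S has exactly one element, that no atom be repeated in the tuple. *)

(* Defs.v *)
From mathcomp Require Import all_boot all_order finmap.

Set Implicit Arguments.
Unset Strict Implicit.
Unset Printing Implicit Defensive.

Local Open Scope fset_scope.

Definition letters (s : seq nat) : {fset nat} := [fset x in s].

Definition perm_of (S : {fset nat}) (s : seq nat) : Prop :=
  uniq s /\ letters s = S.

Definition smallest (T : {fset nat}) (x : nat) : Prop :=
  x \in T /\ forall y, y \in T -> (x <= y)%N.

Definition largest (T : {fset nat}) (x : nat) : Prop :=
  x \in T /\ forall y, y \in T -> (y <= x)%N.

(* The default value 0 of [head] and [last] is never reached in what follows:
   atomic words permute a non-empty set. *)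
Definition rising (T : {fset nat}) (s : seq nat) : Prop :=
  smallest T (head 0 s) /\ largest T (last 0 s).

Definition falling (T : {fset nat}) (s : seq nat) : Prop :=
  largest T (head 0 s) /\ smallest T (last 0 s).

Definition atomic (T : {fset nat}) (s : seq nat) : Prop :=
  [/\ T != fset0, perm_of T s & rising T s \/ falling T s].

(* [infix] is the relation "block of consecutive letters". *)
Definition contains_atomic (S : {fset nat}) (sigma : seq nat)
    (T : {fset nat}) (pi : seq nat) : Prop :=
  [/\ T `<=` S, atomic T pi & infix pi sigma].

Definition inextendible (S : {fset nat}) (sigma : seq nat)
    (T : {fset nat}) (pi : seq nat) : Prop :=
  contains_atomic S sigma T pi /\
  ~ (exists (T' : {fset nat}) (pi' : seq nat),
       contains_atomic S sigma T' pi' /\ T `<` T').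

(* The tuple of words is a sequence [pis], of arbitrary length; the set
   permuted by each word is necessarily the set of its letters. *)
Definition atomic_decomposition (S : {fset nat}) (sigma : seq nat)
    (pis : seq (seq nat)) : Prop :=
  [/\ forall pi, pi \in pis -> inextendible S sigma (letters pi) pi,
      forall i, (i.+1 < size pis)%N ->
        last 0 (nth [::] pis i) = head 0 (nth [::] pis i.+1)
    & \bigcup_(pi <- pis) letters pi = S].

(* Main.v *)
(** An atomic word in [sigma] is an interval of positions. If two atomic
intervals share at least two positions, then their union is atomic; hence
distinct inextendible intervals share at most one position. Two adjacent
letters form an atomic word, which lies in an inextendible one, so from the
end of an inextendible interval another one must start: walking from the first
position to the last gives existence. An inextendible interval is determined by
its first letter, which gives uniqueness. *)
Require Import Defs.
From mathcomp Require Import all_boot all_order finmap zify.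

Set Implicit Arguments.
Unset Strict Implicit.
Unset Printing Implicit Defensive.

Local Open Scope fset_scope.

(** * Blocks of a word as closed intervals of positions *)

Definition block (s : seq nat) a b : seq nat :=
  take (b - a).+1 (drop a s).

(** Quantifying over ordinals keeps this boolean, so that a longest atomic interval can be selected
    by [arg_maxnP]. *)
Definition monotone_ends (s : seq nat) a b : bool :=
  [forall i : 'I_(size s), (a <= i <= b) ==>
     (nth 0 s a <= nth 0 s i <= nth 0 s b)] ||
  [forall i : 'I_(size s), (a <= i <= b) ==>
     (nth 0 s b <= nth 0 s i <= nth 0 s a)].

Definition atomic_interval (s : seq nat) a b : bool :=
  (a <= b < size s) && monotone_ends s a b.

Definition maximal_interval (s : seq nat) a b : Prop :=
  atomic_interval s a b /\
  forall c d, c <= a -> b <= d -> atomic_interval s c d -> c = a /\ d = b.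

Definition link (p q : seq nat) : bool := last 0 p == head 0 q.

Lemma size_block s a b : a <= b < size s -> size (block s a b) = (b - a).+1.
Proof. by move=> ab; rewrite size_take size_drop; case: ifP; lia. Qed.

Lemma nth_block s a b i : i <= b - a -> nth 0 (block s a b) i = nth 0 s (a + i).
Proof. by move=> ib; rewrite nth_take ?nth_drop. Qed.

Lemma head_block s a b : head 0 (block s a b) = nth 0 s a.
Proof. by rewrite -nth0 nth_block // addn0. Qed.

Lemma last_block s a b : a <= b < size s -> last 0 (block s a b) = nth 0 s b.
Proof.
move=> ab; rewrite -nth_last size_block //= nth_block //.
by congr nth; lia.
Qed.

Lemma nth_nat_inj (s : seq nat) i j : uniq s -> nth 0 s i = nth 0 s j ->
  i < size s -> j < size s -> i = j.
Proof. by move=> us /eqP e ilt jlt; apply/eqP; rewrite -(nth_uniq 0 ilt jlt us). Qed.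

Lemma mem_letters s x : (x \in letters s) = (x \in s).
Proof. by rewrite in_fset. Qed.

Lemma mem_blockP s a b x : a <= b < size s ->
  reflect (exists2 i, a <= i <= b & x = nth 0 s i) (x \in block s a b).
Proof.
move=> ab; apply: (iffP (nthP 0)) => [[i]|[i ai ->]].
  rewrite size_block // => ib <-; exists (a + i)%N; first by lia.
  by rewrite nth_block.
exists (i - a); first by rewrite size_block //; lia.
by rewrite nth_block; [congr nth|]; lia.
Qed.

Lemma infix_block s a b : infix (block s a b) s.
Proof.
by apply: (@infix_trans _ (drop a s)); [exact: infix_take | exact: infix_drop].
Qed.

Lemma infixE_block (s p : seq nat) : p != [::] -> infix p s ->
  exists a b, a <= b < size s /\ p = block s a b.
Proof.
move=> p0 inf; have sp : 0 < size p by rewrite lt0n size_eq0.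
have [u [v ->]] : exists u v : seq nat, s = u ++ p ++ v by exact/infixP.
exists (size u), (size u + (size p).-1)%N; split.
  by rewrite !size_cat; lia.
rewrite /block drop_size_cat // take_size_cat //; lia.
Qed.

(** Distinct letters determine their positions, so comparing letter sets amounts to comparing
    intervals. *)
Lemma letters_block_sub (s : seq nat) a b c d : uniq s -> a <= b < size s -> c <= d < size s ->
  letters (block s a b) `<=` letters (block s c d) -> c <= a /\ b <= d.
Proof.
move=> us ab cd /fsubsetP sub.
have inside i : a <= i <= b -> c <= i <= d.
  move=> ai; have := sub (nth 0 s i); rewrite !mem_letters.
  case/(_ _)/mem_blockP => //; first by apply/mem_blockP => //; exists i.
  by move=> j cj /(nth_nat_inj us); lia.
by have := inside a; have := inside b; lia.
Qed.

Lemma block_letters_sub s a b c d : a <= b < size s -> c <= d < size s ->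
  c <= a -> b <= d -> letters (block s a b) `<=` letters (block s c d).
Proof.
move=> ab cd ca bd; apply/fsubsetP => x; rewrite !mem_letters.
case/mem_blockP => // i ai ->; apply/mem_blockP => //; exists i => //; lia.
Qed.

(** * From atomic words to atomic intervals *)

Lemma monotone_endsP s a b : a <= b < size s ->
  reflect ((forall i, a <= i <= b -> nth 0 s a <= nth 0 s i <= nth 0 s b) \/
           (forall i, a <= i <= b -> nth 0 s b <= nth 0 s i <= nth 0 s a))
          (monotone_ends s a b).
Proof.
move=> ab; apply: (iffP orP) => -[h|h].
- left=> i ai; have ilt : i < size s by lia.
  by move/forallP/(_ (Ordinal ilt))/implyP/(_ ai): h.
- right=> i ai; have ilt : i < size s by lia.
  by move/forallP/(_ (Ordinal ilt))/implyP/(_ ai): h.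
- by left; apply/forallP => i; apply/implyP/h.
- by right; apply/forallP => i; apply/implyP/h.
Qed.

(** A non-empty factor is a block, and extremality of its two end letters in [T] is exactly
    [monotone_ends]. *)
Lemma contains_atomicP S s T p : perm_of S s ->
  contains_atomic S s T p <->
  exists a b, [/\ atomic_interval s a b, p = block s a b & T = letters p].
Proof.
case=> us lS; split.
  case=> _ [T0 [up lT] ends] inf.
  have p0 : p != [::].
    apply: contraNneq T0 => p0; apply/eqP/fsetP => x.
    by rewrite -lT p0 mem_letters in_fset0.
  have [a [b [ab pE]]] := infixE_block p0 inf.
  exists a, b; split => //; rewrite /atomic_interval ab /=.
  have inT i : a <= i <= b -> nth 0 s i \in T.
    by move=> ai; rewrite -lT mem_letters pE; apply/mem_blockP => //; exists i.
  apply/monotone_endsP => //; move: ends.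
  rewrite /rising /falling /smallest /largest pE head_block last_block //.
  by case=> -[[_ h1] [_ h2]]; [left|right] => i /inT iT; rewrite h1 ?h2.
case=> a [b [/andP[ab me] pE TE]]; have inT i : a <= i <= b -> nth 0 s i \in T.
  by move=> ai; rewrite TE mem_letters pE; apply/mem_blockP => //; exists i.
have ST : T `<=` S.
  apply/fsubsetP => x; rewrite TE -lS !mem_letters pE.
  by apply: mem_infix; exact: infix_block.
split=> //; last by rewrite pE infix_block.
split.
- by apply/fset0Pn; exists (nth 0 s a); apply: inT; lia.
- by split=> //; rewrite pE; apply: infix_uniq us; exact: infix_block.
- have [aT bT] : nth 0 s a \in T /\ nth 0 s b \in T by split; apply: inT; lia.
  have hE : head 0 p = nth 0 s a by rewrite pE head_block.
  have lE : last 0 p = nth 0 s b by rewrite pE last_block.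
  rewrite /rising /falling /smallest /largest hE lE.
  have Tn y : y \in T -> exists2 i, a <= i <= b & y = nth 0 s i.
    by rewrite TE mem_letters pE => /mem_blockP; apply.
  by case/monotone_endsP: me => // h; [left|right];
    split; split => // y /Tn[i /h/andP[? ?] ->].
Qed.

Lemma inextendibleP S s p : perm_of S s ->
  inextendible S s (letters p) p <->
  exists a b, maximal_interval s a b /\ p = block s a b.
Proof.
move=> Ss; have [us _] := Ss; split.
  case=> /(contains_atomicP _ _ Ss)[a [b [at_ab pE _]]] noext.
  exists a, b; split=> //; split=> // c d ca bd at_cd.
  have [ab cd] : a <= b < size s /\ c <= d < size s.
    by case/andP: at_ab; case/andP: at_cd.
  (* Either the larger interval brings no new letter, hence no new position, or its letter set is a
     forbidden strict extension. *)
  have [sub|nsub] := boolP (letters (block s c d) `<=` letters (block s a b)).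
    by have := letters_block_sub us cd ab sub; lia.
  case: noext; exists (letters (block s c d)), (block s c d); split.
    by apply/(contains_atomicP _ _ Ss); exists c, d.
  by rewrite fproperE pE nsub andbT block_letters_sub.
case=> a [b [[at_ab mx] pE]]; split.
  by apply/(contains_atomicP _ _ Ss); exists a, b.
case=> T [q [/(contains_atomicP _ _ Ss)[c [d [at_cd qE ->]]]]].
have [ab cd] : a <= b < size s /\ c <= d < size s.
  by case/andP: at_ab; case/andP: at_cd.
rewrite fproperE pE qE => /andP[/(letters_block_sub us ab cd)[ca bd]].
by have [-> ->] := mx c d ca bd at_cd; rewrite fsubset_refl.
Qed.

(** * Overlaps and maximal intervals *)

(** The distinct letters at [c] and [b] lie in both intervals, and their order forces the same
    direction on both. If rising, the letter at [a] is at most the one at [c], and the letter at [b]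
    at most the one at [d], so the outer ends bound everything; falling is symmetric. *)
Lemma atomic_interval_union (s : seq nat) a b c d : uniq s ->
  a <= c < b -> b <= d -> atomic_interval s a b -> atomic_interval s c d ->
  atomic_interval s a d.
Proof.
move=> us acb bd /andP[ab /(monotone_endsP ab) hab].
move=> /andP[cd /(monotone_endsP cd) hcd].
have ad : a <= d < size s by lia.
have cb : nth 0 s c <> nth 0 s b by move/(nth_nat_inj us); lia.
rewrite /atomic_interval ad; apply/monotone_endsP => //.
have split_i i : a <= i <= d -> a <= i <= b \/ c <= i <= d by lia.
case: hab hcd => hab [] hcd; have hc := hab c; have hb := hcd b; try lia.
- left=> i /split_i[/hab|/hcd]; have := hcd c; have := hab a; lia.
- right=> i /split_i[/hab|/hcd]; have := hcd c; have := hab a; lia.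
Qed.

Lemma maximal_interval_inj_start s a b b' :
  maximal_interval s a b -> maximal_interval s a b' -> b = b'.
Proof.
case=> at1 m1 [at2 m2]; have [le|/ltnW le] := leqP b b'.
  by case: (m1 a b').
by case: (m2 a b).
Qed.

(** The first interval, or else the union, is an atomic interval starting at [a] that contains the
    second one, whose maximality then gives [c = a]. *)
Lemma maximal_interval_overlap (s : seq nat) a b c d : uniq s ->
  maximal_interval s a b -> maximal_interval s c d -> a <= c < b -> c = a.
Proof.
move=> us [at1 m1] [at2 m2] acb; have [le|/ltnW le] := leqP d b.
  by have [->] := m2 a b ltac:(lia) le at1.
have at3 := atomic_interval_union us acb le at1 at2.
by have [->] := m2 a d ltac:(lia) (leqnn d) at3.
Qed.

Lemma atomic_in_maximal s a b : atomic_interval s a b ->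
  exists c d, [/\ c <= a, b <= d & maximal_interval s c d].
Proof.
move=> at_ab; have /andP[ab _] := at_ab.
have [alt blt] : a < size s /\ b < size s by lia.
(* Finitely many atomic intervals contain the given one; a longest of them is maximal. *)
pose P (p : 'I_(size s) * 'I_(size s)) :=
  [&& p.1 <= a, b <= p.2 & atomic_interval s p.1 p.2].
have P0 : P (Ordinal alt, Ordinal blt) by rewrite /P /= !leqnn.
case: (arg_maxnP (fun p : 'I_(size s) * 'I_(size s) => p.2 - p.1) P0).
case=> c d /and3P[/= ca bd at_cd] mx; exists c, d; split=> //; split=> //.
move=> c' d' cc dd at'; have /andP[cd' _] := at'.
have [clt dlt] : c' < size s /\ d' < size s by lia.
have /mx /= : P (Ordinal clt, Ordinal dlt).
  by apply/and3P; split=> //=; lia.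
have /andP[cd _] := at_cd; lia.
Qed.

Lemma atomic_interval_adjacent s a : a.+1 < size s -> atomic_interval s a a.+1.
Proof.
move=> alt; have aa : a <= a.+1 < size s by lia.
rewrite /atomic_interval aa; apply/monotone_endsP => //.
have two i : a <= i <= a.+1 -> i = a \/ i = a.+1 by lia.
by have [le|/ltnW le] := leqP (nth 0 s a) (nth 0 s a.+1); [left|right];
  move=> i /two[] ->; rewrite ?leqnn ?le.
Qed.

Lemma maximal_interval_lt s a b : 1 < size s -> maximal_interval s a b -> a < b.
Proof.
move=> s1 [at_ab mx]; have /andP[ab _] := at_ab.
rewrite ltn_neqAle; apply/andP; split; last by lia.
apply/eqP => eab; rewrite -{}eab in mx ab.
have [alt|age] := ltnP a.+1 (size s).
  by have [] := mx a a.+1 (leqnn a) (leqnSn a) (atomic_interval_adjacent alt); lia.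
(* At the last position the neighbour is on the left; it exists because [s] has at least two
   letters. *)
have a1 : a.-1.+1 = a by lia.
have := @atomic_interval_adjacent s a.-1; rewrite a1 => /(_ ltac:(lia)) at'.
by have [] := mx a.-1 a (leq_pred a) (leqnn a) at'; lia.
Qed.

(** Take a maximal interval around the positions [b] and [b.+1]. If it began before [b], it would
    share two positions with the interval ending at [b], hence coincide with it, yet it reaches past
    [b]. The case [b = 0] starts the walk, with no preceding interval. *)
Lemma maximal_interval_from (s : seq nat) a b : uniq s -> b.+1 < size s ->
  b = 0 \/ maximal_interval s a b -> exists2 d, b < d & maximal_interval s b d.
Proof.
move=> us blt; have [c [d [cb bd mcd]]] :=
  atomic_in_maximal (atomic_interval_adjacent blt).
case=> [b0|mab]; first by exists d => //; rewrite (_ : b = c) //; lia.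
have ab : a < b by apply: maximal_interval_lt mab; lia.
exists d => //; have [->//|nbc] := eqVneq b c.
suff cE : c = a by move: mcd; rewrite cE => /(maximal_interval_inj_start mab); lia.
have [le|lt] := leqP a c.
  by apply: maximal_interval_overlap mab mcd _ => //; lia.
by rewrite (maximal_interval_overlap us mcd mab) //; lia.
Qed.

(** * Chains of maximal intervals *)

(** The block from [a] to [b] is the one just passed, and the induction is on the distance from [b]
    to the end. Coverage is claimed only when a letter follows [b], since otherwise the remaining
    chain is empty. *)
Lemma maximal_chain_exists (s : seq nat) a b : uniq s -> a <= b < size s ->
  b = 0 \/ maximal_interval s a b ->
  exists pis, [/\ path link (block s a b) pis,
    forall p, p \in pis -> exists c d, maximal_interval s c d /\ p = block s c d
    & forall i, b <= i < size s -> b.+1 < size s ->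
        exists2 p, p \in pis & nth 0 s i \in p].
Proof.
move=> us; move: {2}(size s - b) (leqnn (size s - b)) => k.
elim: k a b => [|k IH] a b; first by lia.
move=> bk ab start; have [blt|bge] := ltnP b.+1 (size s); last first.
  by exists [::]; split.
have [d bd mbd] := maximal_interval_from us blt start.
have bds : b <= d < size s by case: mbd => /andP[].
have [pis [lk mx cov]] := IH b d ltac:(lia) bds (or_intror mbd).
exists (block s b d :: pis); split.
- by rewrite /= {1}/link last_block // head_block eqxx.
- move=> p; rewrite inE => /orP[/eqP ->|/mx //]; by exists b, d.
- move=> i bi _; have [id|di] := leqP i d.
    exists (block s b d); first by rewrite mem_head.
    by apply/mem_blockP => //; exists i => //; lia.
  have [p pin ip] := cov i ltac:(lia) ltac:(lia).
  by exists p => //; rewrite inE pin orbT.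
Qed.

Lemma maximal_chain_unique (s p : seq nat) ps qs : uniq s -> 1 < size s ->
  (forall q, q \in ps -> exists c d, maximal_interval s c d /\ q = block s c d) ->
  (forall q, q \in qs -> exists c d, maximal_interval s c d /\ q = block s c d) ->
  path link p ps -> path link p qs ->
  last 0 (last p ps) = last 0 s -> last 0 (last p qs) = last 0 s -> ps = qs.
Proof.
(* A chain that has reached the last letter must stop: a further block would start at the last
   position, but a maximal interval has at least two positions. *)
move=> us s1; have nolink q r rs : 
    (forall t, t \in r :: rs -> exists c d, maximal_interval s c d /\ t = block s c d) ->
    link q r -> last 0 q = last 0 s -> False.
  move=> /(_ r (mem_head _ _))[c [d [mcd ->]]] /eqP ->.
  have cd := maximal_interval_lt s1 mcd; have [/andP[cds _] _] := mcd.
  by rewrite head_block -nth_last => /(nth_nat_inj us); lia.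
elim: ps p qs => [|q ps IH] p [|r qs] //= mp mq.
- by move=> _ /andP[lk _] /(nolink _ _ _ mq lk).
- by move=> /andP[lk _] _ _ /(nolink _ _ _ mp lk).
move=> /andP[/eqP lq pq] /andP[/eqP lr pr] eq er.
have [c [d [mcd qE]]] := mp q (mem_head _ _).
have [c' [d' [mcd' rE]]] := mq r (mem_head _ _).
(* Both blocks start with the last letter of [p], hence at the same position, and maximality fixes
   where they end. *)
have qr : q = r.
  have [/andP[? _] _] := mcd; have [/andP[? _] _] := mcd'.
  have : head 0 q = head 0 r by rewrite -lq.
  rewrite qE rE !head_block => /(nth_nat_inj us) cc.
  have {}cc : c = c' by lia.
  by move: mcd'; rewrite -cc => /(maximal_interval_inj_start mcd) ->.
rewrite -qr in pr er *; congr cons; apply: (IH q) => // t tin.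
  by apply: mp; rewrite inE tin orbT.
by apply: mq; rewrite inE tin orbT.
Qed.

(** * Decompositions as chains *)

Lemma sorted_linkP pis :
  reflect (forall i, i.+1 < size pis ->
             last 0 (nth [::] pis i) = head 0 (nth [::] pis i.+1))
          (sorted link pis).
Proof.
apply: (iffP (sortedP [::])) => h i /h; first by move/eqP.
by move=> e; apply/eqP.
Qed.

Lemma bigfcup_lettersP x (pis : seq (seq nat)) :
  reflect (exists2 p, p \in pis & x \in p) (x \in \bigcup_(p <- pis) letters p).
Proof.
apply: (iffP (bigfcupP _ _ _ _)) => -[p].
  by rewrite andbT mem_letters; exists p.
by exists p; rewrite ?andbT ?mem_letters.
Qed.

(** The one-letter block at position 0 serves as a virtual predecessor: linking to it says that the
    first atom begins at the start of [s]. *)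
Lemma atomic_decomposition_chain S s pis : perm_of S s -> 1 < size s ->
  atomic_decomposition S s pis ->
  [/\ forall q, q \in pis -> exists c d, maximal_interval s c d /\ q = block s c d,
      path link (block s 0 0) pis
    & last 0 (last (block s 0 0) pis) = last 0 s].
Proof.
move=> Ss s1 [inx lk cup]; have [us lS] := Ss.
have mx q : q \in pis -> exists c d, maximal_interval s c d /\ q = block s c d.
  by move=> /inx/(inextendibleP _ Ss).
have cov i : i < size s -> exists j a b, [/\ j < size pis, maximal_interval s a b,
    nth [::] pis j = block s a b & a <= i <= b].
  move=> ilt; have : nth 0 s i \in S by rewrite -lS mem_letters mem_nth.
  rewrite -cup => /bigfcup_lettersP[p /(nthP [::])[j jlt <-]].
  have [a [b [mab e]]] := mx _ (mem_nth [::] jlt).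
  have [/andP[ab _] _] := mab; rewrite e; case/mem_blockP => // k ak /(nth_nat_inj us) ik.
  have {}ik : i = k by lia.
  by rewrite ik; exists j, a, b.
have nthE j : j < size pis -> exists a b, [/\ maximal_interval s a b, a < b < size s,
    nth [::] pis j = block s a b & last 0 (nth [::] pis j) = nth 0 s b].
  move=> jlt; have [a [b [mab e]]] := mx _ (mem_nth [::] jlt).
  have lt := maximal_interval_lt s1 mab; have [/andP[ab _] _] := mab.
  by exists a, b; split=> //; [lia | rewrite e last_block].
split=> //.
(* If the atom covering position 0 had a predecessor, that one would end at position 0, impossible
   with two positions. *)
- have [[|j] [a [b [jlt mab e ab]]]] := cov 0 ltac:(lia).
    case: pis {inx cup mx cov nthE} e jlt lk => //= q pis -> _ lk.
    apply/andP; split; last exact/(sorted_linkP (block s a b :: pis)).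
    rewrite /link last_block ?head_block; last by lia.
    by apply/eqP; congr nth; lia.
  have [a' [b' [_ ab' _ e']]] := nthE j ltac:(lia).
  move: (lk j jlt); rewrite e e' head_block => /(nth_nat_inj us); lia.
(* Likewise an atom following the one that covers the last position would have no room. *)
- have [j [a [b [jlt mab e ab]]]] := cov (size s).-1 ltac:(lia).
  have [/andP[abs _] _] := mab.
  have [lt|ge] := ltnP j.+1 (size pis).
    have [a' [b' [_ ab' e' _]]] := nthE j.+1 lt.
    move: (lk j lt); rewrite e e' head_block last_block // => /(nth_nat_inj us); lia.
  have jE : j = (size pis).-1 by lia.
  case: pis jE {inx lk cup mx cov nthE} e jlt ge => //= q pis -> e _ _.
  have -> : last q pis = block s a b by rewrite -e (last_nth [::]).
  by rewrite last_block // -nth_last; congr nth; lia.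
Qed.

Lemma card_letters s : uniq s -> #|` letters s| = size s.
Proof. by move=> us; rewrite card_fseq undup_id. Qed.

Lemma chain_atomic_decomposition S s pis : perm_of S s ->
  (forall q, q \in pis -> exists c d, maximal_interval s c d /\ q = block s c d) ->
  sorted link pis -> (forall x, x \in s -> exists2 p, p \in pis & x \in p) ->
  atomic_decomposition S s pis.
Proof.
move=> Ss mx /sorted_linkP lk cov; have [_ lS] := Ss; split=> //.
  by move=> p /mx/(inextendibleP _ Ss).
apply/fsetP => x; rewrite -lS mem_letters; apply/bigfcup_lettersP/idP => [|/cov //].
case=> p /mx[c [d [_ ->]]]; apply: mem_infix; exact: infix_block.
Qed.

(** For a singleton [S], the one-letter word repeated any positive number of times satisfies
    [atomic_decomposition]; the condition [uniq pis] selects the single copy. *)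
Theorem proposition2 (S : {fset nat}) (sigma : seq nat) :
  perm_of S sigma ->
  exists! pis : seq (seq nat),
    atomic_decomposition S sigma pis /\ (#|` S| = 1%N -> uniq pis).
Proof.
move=> Ss; have [us lS] := Ss; rewrite -{2}lS card_letters //.
have [s1|] := ltnP 1 (size sigma).
  have [pis [lk mx cov]] :=
    @maximal_chain_exists sigma 0 0 us (ltnW s1) (or_introl erefl).
  have dec : atomic_decomposition S sigma pis.
    apply: chain_atomic_decomposition (path_sorted lk) _ => // x xs.
    have [i ilt <-] := nthP 0 xs; exact: cov.
  have [_ _ end_] := atomic_decomposition_chain Ss s1 dec.
  exists pis; split; first by split=> // e; rewrite e in s1.
  move=> pis' [/(atomic_decomposition_chain Ss s1)[mx' lk' end'] _].
  exact: maximal_chain_unique lk lk' end_ end'.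
have only_block pis : size sigma <= 1 -> atomic_decomposition S sigma pis ->
    forall p, p \in pis -> 0 < size sigma /\ p = block sigma 0 0.
  move=> s1 [inx _ _] p /inx/(inextendibleP _ Ss)[a [b [[/andP[ab _] _] ->]]].
  have [a0 b0] : a = 0 /\ b = 0 by lia.
  by rewrite a0 b0 in ab *; split=> //; lia.
case: ltngtP => // s1 _.
  (* The empty word has the empty tuple, as an atom would need a letter. *)
  have s0 : size sigma = 0 by lia.
  exists [::]; split.
    split=> //; apply: chain_atomic_decomposition => //.
    by move=> x; rewrite (size0nil s0).
  move=> [|p pis] // [/(only_block _ (ltnW s1)) mx _].
  by have [] := mx p (mem_head _ _); rewrite s0.
have at0 : atomic_interval sigma 0 0.
  rewrite /atomic_interval s1; apply/monotone_endsP; first by rewrite s1.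
  by left=> -[|i]; rewrite ?leqnn.
have mx0 : maximal_interval sigma 0 0.
  by split=> // c d _ _ /andP[cd _]; lia.
have decs : atomic_decomposition S sigma [:: block sigma 0 0].
  apply: chain_atomic_decomposition => // [q|x /(nthP 0)[i ilt <-]].
    by rewrite inE => /eqP ->; exists 0, 0.
  exists (block sigma 0 0); first exact: mem_head.
  by apply/mem_blockP; [rewrite s1 | exists i => //; rewrite s1 in ilt].
exists [:: block sigma 0 0]; split=> // pis [dec /(_ s1) upis].
have mx := only_block pis ltac:(lia) dec.
(* All atoms equal the one-letter word: covering [S] requires one copy, and [uniq] excludes two. *)
case: pis dec upis mx => [|p [|q pis]] dec upis mx.
- have [_ _ cup] := dec.
  have : nth 0 sigma 0 \in S by rewrite -lS mem_letters mem_nth // s1.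
  by rewrite -cup => /bigfcup_lettersP[].
- by have [_ ->] := mx p (mem_head _ _).
- have [_ pE] := mx p (mem_head _ _).
  have [_ qE] := mx q ltac:(by rewrite !inE eqxx orbT).
  by move: upis; rewrite /= pE qE mem_head.
Qed.
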